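(* Let $n$ be a sufficiently large positive integer and $m$ an integer with $n^{6}\le m\le n^{C}$ for a fixed constant $C$. Then $M_{\mathsf{SH}}(m,n)\le \mathcal{O}(\sqrt{n\log\log n})$.
   Context: $[N]=\{0,\dots,N-1\}$; $\mathfrak{m}_m(x)$ is the unique element of $(x+m\mathbb{Z})\cap[0,m)$; $\mathbb{Z}_m^{\times}$ is the set of $k\in[m]$ coprime to $m$. Smart linear hashing $\mathsf{SH}_m$ into $n$ bins: choose $a$ uniformly from $\mathbb{Z}_m^{\times}$ and place $x\in[m]$ in bin $\lfloor\mathfrak{m}_m(ax)/(m/n)\rfloor$. The maxload on $X$ is the number of elements of $X$ in the fullest bin; $M_{\mathsf{SH}}(m,n)$ is the maximum over $n$-element $X\subset[m]$ of the expected maxload of $\mathsf{SH}_m$ on $X$. *)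

(* Defs.v *)
From HB Require Import structures.
From mathcomp Require Import all_boot all_order all_algebra.
From mathcomp Require Import all_classical all_reals all_analysis.

Set Implicit Arguments.
Unset Strict Implicit.
Unset Printing Implicit Defensive.

Import Order.TTheory GRing.Theory Num.Theory.

Local Open Scope ring_scope.

(* The universe [m] is 'I_m, whose elements coerce to nat; on products of
   naturals the representative of a * x in [0, m) is (a * x) %% m. *)

Definition mult_units (m : nat) : {set 'I_m} := [set a : 'I_m | coprime a m].

(* The bin width m / n is an exact rational, not a truncated quotient. *)
Definition sh_bin (m n : nat) (a x : 'I_m) : int :=
  Num.floor (((a * x) %% m)%N%:R / (m%:R / n%:R) : rat).

Definition sh_maxload (m n : nat) (X : {set 'I_m}) (a : 'I_m) : nat :=
  \max_(b < n) #|[set x in X | sh_bin n a x == b%:Z]|.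

(* Expectation over a drawn uniformly from mult_units m. *)
Definition sh_expected_maxload (R : realType) (m n : nat) (X : {set 'I_m}) : R :=
  (\sum_(a in mult_units m) (sh_maxload n X a)%:R) / #|mult_units m|%:R.

(* The default 0 of the iterated maximum is harmless: expected maxloads are
   nonnegative, and for n <= m the family of n-element sets is nonempty. *)
Definition M_SH (R : realType) (m n : nat) : R :=
  \big[Num.max/0]_(X : {set 'I_m} | #|X| == n) sh_expected_maxload R n X.

(* Main.v *)
(** Two keys x <> y collide only if a (x - y) mod m lies within m / n of 0.
    Writing g = gcd (x - y, m), the values a (x - y) mod m, for a in [m], are
    multiples of g, each taken g times, so at most 2 m / n of all a in [m] make x
    and y collide.  Relative to the units this is a fraction of at most
    (2 / n) (m / phi m), and m / phi m = O(log log m) = O(log log n) by the upper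
    bounds in Mertens' theorems.  Hence the expected number of ordered colliding
    pairs, which bounds the expected square of the maxload, is O(n log log n). *)

Require Import Defs.
From HB Require Import structures.
From mathcomp Require Import all_boot all_order all_algebra.
From mathcomp Require Import all_classical all_reals all_analysis.
From mathcomp Require Import zify ring lra.

Set Implicit Arguments.
Unset Strict Implicit.
Unset Printing Implicit Defensive.

Import Order.TTheory GRing.Theory Num.Theory.

Local Open Scope ring_scope.

(** * Chebyshev's upper bound on the primorial *)

(** Powers of distinct primes are coprime, so divisibility can be checked one prime at a time. The
    exponent [e] is 1 for primorials and radicals, and [n %/ p] for factorials. *)
Lemma dvdn_prod_prime_powers (r : seq nat) (P : pred nat) (e : nat -> nat)
    (N : nat) :
    uniq r -> {in r, forall p, P p -> prime p && (p ^ e p %| N)%N} ->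
  (\prod_(p <- r | P p) p ^ e p %| N)%N.
Proof.
elim: r => [|q r IHr] /=; first by rewrite big_nil dvd1n.
move=> /andP[qr ur] H; rewrite big_cons.
have IH : (\prod_(p <- r | P p) p ^ e p %| N)%N.
  by apply: IHr => // p pr; apply: H; rewrite inE pr orbT.
case: ifP => // Pq.
have /andP[prq dvq] := H q (mem_head _ _) Pq.
rewrite Gauss_dvd ?dvq ?IH//.
rewrite big_seq_cond; elim/big_ind: _ => [|x y cx cy|p /andP[pr Pp]].
- exact: coprimen1.
- by rewrite coprimeMr cx.
have /andP[prp _] : prime p && (p ^ e p %| N)%N.
  by apply: H => //; rewrite inE pr orbT.
apply: coprimeXl; apply: coprimeXr; rewrite prime_coprime// dvdn_prime2//.
by apply: contraNneq qr => ->.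
Qed.

Lemma prime_dvd_fact (p n : nat) : prime p -> (p %| n`!)%N = (p <= n)%N.
Proof.
move=> pp; apply/idP/idP; last by move=> pn; rewrite dvdn_fact// prime_gt0.
elim: n => [|n IHn]; first by rewrite fact0 dvdn1 => /eqP p1; rewrite p1 in pp.
by rewrite factS Euclid_dvdM// => /orP[/dvdn_leq->//|/IHn /leqW].
Qed.

(** The two equal middle terms of (1 + 1) ^ (2k + 1) sum to at most 2 * 4 ^ k. *)
Lemma bin_odd_central_le (k : nat) : ('C(k.*2.+1, k) <= 4 ^ k)%N.
Proof.
have := expnDn 1 1 k.*2.+1.
under eq_bigr do rewrite !exp1n !muln1.
rewrite addn1 expnS -mul2n expnM -[(2 ^ 2)%N]/4%N => E.
have i1 : (k < (2 * k).+2)%N by lia.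
have i2 : (k.+1 < (2 * k).+2)%N by lia.
move: E; rewrite (bigD1 (Ordinal i1)) //= (bigD1 (Ordinal i2)) /=; last first.
  by rewrite -val_eqE /=; lia.
have -> : ('C((2 * k).+1, k.+1) = 'C((2 * k).+1, k))%N.
  by rewrite -bin_sub; [congr 'C(_, _); lia|lia].
by lia.
Qed.

(** Erdős's argument: a composite top index adds no factor, and a prime one above 2 has the form 2k
    + 1. Every prime from k + 2 to 2k + 1 divides (2k + 1)! but neither k! nor (k + 1)!, hence
    divides ['C(k.*2.+1, k)]. *)
Lemma primorial_le (n : nat) : (\prod_(0 <= p < n.+1 | prime p) p <= 4 ^ n)%N.
Proof.
elim/ltn_ind: n => -[|n] IHn; first by rewrite big_mkcond big_nat1.
have [np|np] := boolP (prime n.+1); last first.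
  rewrite big_mkcond big_nat_recr//= -big_mkcond (negPf np) muln1.
  by rewrite (leq_trans (IHn n _))// leq_exp2l.
case: n IHn np => [|n] IHn np; first by [].
have [on|en] := boolP (odd n); last first.
  have [|] := even_prime np; first by move=> [->]; rewrite unlock.
  by rewrite /= negbK (negPf en).
have nE : n.+2 = n.+1./2.*2.+1 by lia.
move: IHn; rewrite nE; set k := n.+1./2 => IHn.
have k0 : (0 < k)%N by rewrite /k; lia.
(* Primes up to k + 1 contribute 4 ^ (k + 1) by induction, the others 4 ^ k. *)
rewrite (@big_cat_nat _ _ _ k.+2) /=; [|lia|lia].
have -> : (4 ^ k.*2.+1 = 4 ^ k.+1 * 4 ^ k)%N by rewrite -expnD; congr expn; lia.
apply: leq_mul; first by apply: IHn; lia.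
apply: leq_trans (bin_odd_central_le k).
apply: dvdn_leq; first by rewrite bin_gt0; lia.
rewrite (eq_bigr (fun p => p ^ 1)%N) => [|p _]; last by rewrite expn1.
apply: dvdn_prod_prime_powers => [|p]; first exact: iota_uniq.
rewrite mem_index_iota => /andP[kp pk] pp; rewrite pp expn1 /=.
have : (p %| (k.*2.+1)`!)%N by rewrite prime_dvd_fact.
rewrite -(@bin_fact _ k); last by lia.
rewrite !Euclid_dvdM// !prime_dvd_fact//.
by case/or3P=> //; lia.
Qed.

Lemma ln_prod_natr (R : realType) (I : Type) (r : seq I) (P : pred I)
    (F : I -> nat) : (forall i, P i -> (0 < F i)%N) ->
  ln ((\prod_(i <- r | P i) F i)%N%:R : R) = \sum_(i <- r | P i) ln (F i)%:R.
Proof.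
move=> F0.
suff [] : ln ((\prod_(i <- r | P i) F i)%N%:R : R)
    = \sum_(i <- r | P i) ln (F i)%:R /\ (0 < \prod_(i <- r | P i) F i)%N by [].
elim/big_ind2: _ => [|x a y b [<- x0] [<- y0]|i Pi]; last by rewrite F0.
- by rewrite ln1.
- by rewrite natrM lnM ?posrE ?ltr0n// muln_gt0 x0 y0.
Qed.

Lemma sum_ln_prime_le (R : realType) (n : nat) :
  \sum_(0 <= p < n.+1 | prime p) ln (p%:R : R) <= n%:R * ln 4.
Proof.
rewrite -ln_prod_natr; last by move=> p /prime_gt0.
rewrite mulr_natl -lnXn// -natrX ler_ln ?posrE ?ltr0n ?expn_gt0// ?ler_nat.
  exact: primorial_le.
by rewrite prodn_cond_gt0// => p /prime_gt0.
Qed.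

(** * Mertens' upper bounds for sums over primes *)

(** Exponentiated, the left side divides n!, because [n %/ p] is the first term of Legendre's
    formula; and n! is at most n ^ n. *)
Lemma sum_divn_ln_prime_le (R : realType) (n : nat) :
  \sum_(0 <= p < n.+1 | prime p) (n %/ p)%:R * ln (p%:R : R) <= n%:R * ln n%:R.
Proof.
case: n => [|n]; first by rewrite big_mkcond big_nat1/= mul0r.
have -> : \sum_(0 <= p < n.+2 | prime p) (n.+1 %/ p)%:R * ln (p%:R : R) =
          \sum_(0 <= p < n.+2 | prime p) ln (p ^ (n.+1 %/ p))%N%:R.
  apply: eq_bigr => p /prime_gt0 p0.
  by rewrite natrX lnXn ?ltr0n// mulr_natl.
rewrite -ln_prod_natr => [|p /prime_gt0]; last by rewrite expn_gt0 => ->.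
rewrite mulr_natl -lnXn ?ltr0n// -natrX ler_ln ?posrE ?ltr0n ?expn_gt0//.
  rewrite ler_nat (@leq_trans (n.+1)`!)//.
    apply: dvdn_leq; first exact: fact_gt0.
    apply: dvdn_prod_prime_powers; first exact: iota_uniq.
    move=> p _ pp; rewrite pp pfactor_dvdn ?fact_gt0// logn_fact//=.
    by rewrite big_nat_recl//= expn1 leq_addr.
  rewrite fact_prod (@leq_trans (\prod_(1 <= i < n.+2) n.+1))//.
    rewrite big_nat_cond [leqRHS]big_nat_cond; apply: leq_prod => i.
    by rewrite andbT => /andP[].
  by rewrite prod_nat_const_nat subn1.
by rewrite prodn_cond_gt0// => p /prime_gt0 p0; rewrite expn_gt0 p0.
Qed.

(* The upper half of Mertens' first theorem. *)
Lemma sum_ln_prime_div_le (R : realType) (n : nat) : (0 < n)%N ->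
  \sum_(0 <= p < n.+1 | prime p) ln (p%:R : R) / p%:R <= ln n%:R + ln 4.
Proof.
move=> n0; have n0' : 0 < n%:R :> R by rewrite ltr0n.
(* After scaling by n, replacing n / p by [n %/ p] costs at most ln p per prime, and Chebyshev's
   bound pays for the total. *)
rewrite -(ler_pM2l n0') mulrDr.
apply: le_trans (lerD (sum_divn_ln_prime_le R n) (sum_ln_prime_le R n)).
rewrite -big_split/= mulr_sumr; apply: ler_sum => p pp.
have p0 : 0 < p%:R :> R by rewrite ltr0n prime_gt0.
rewrite -[X in _ + X]mul1r -mulrDl mulrCA [leLHS]mulrC ler_wpM2r//.
  by apply: ln_ge0; rewrite ler1n prime_gt0.
rewrite ler_pdivrMr// natr1 -natrM ler_nat.
by rewrite ltnW// ltn_ceil// prime_gt0.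
Qed.

(* Summation by parts against 1 / ln p; the increments telescope because
   1 - ln N / ln (N + 1) <= ln (ln (N + 1)) - ln (ln N). *)
Lemma sum_inv_prime_le (R : realType) (n : nat) : (2 <= n)%N ->
  \sum_(0 <= p < n.+1 | prime p) (p%:R : R)^-1 <= ln (ln n%:R) + (3 - ln (ln 2)).
Proof.
pose S k : R := \sum_(0 <= p < k.+1 | prime p) ln (p%:R : R) / p%:R.
pose T k : R := \sum_(0 <= p < k.+1 | prime p) (p%:R : R)^-1.
have l2 : 0 < ln (2 : R) by apply: ln_gt0; rewrite ltr1n.
have l4 : ln (4 : R) = 2 * ln 2.
  have -> : (4 : R) = 2 ^+ 2 by rewrite -natrX.
  by rewrite lnXn// mulr_natl.
have lk k : (2 <= k)%N -> 0 < ln (k%:R : R) by move=> k2; apply: ln_gt0; rewrite ltr1n.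
suff H : (2 <= n)%N -> T n <= S n / ln n%:R + ln (ln n%:R) - ln (ln 2)
                   + ln 4 * ((ln 2)^-1 - (ln n%:R)^-1).
  move=> n2; apply: le_trans (H n2) _.
  have := @sum_ln_prime_div_le R n (ltnW n2); rewrite -/(S n) => Sn.
  have : S n / ln n%:R <= 1 + ln 4 / ln n%:R.
    rewrite ler_pdivrMr ?lk// mulrDl mul1r divfK ?gt_eqF ?lk//.
  (* The terms ln 4 / ln n cancel; the constant 3 is 1 plus ln 4 / ln 2. *)
  have e : ln (4 : R) / ln 2 = 2 by rewrite l4 mulfK ?gt_eqF.
  rewrite mulrBr e.
  by lra.
elim: n => [//|n IHn]; rewrite leq_eqVlt => /predU1P[<-|n2].
  rewrite /T /S subrr mulr0 addr0 addrK.
  rewrite unlock /= !addr0 mulrAC divff ?gt_eqF// mul1r//.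
have TE : T n.+1 = T n + (if prime n.+1 then (n.+1%:R)^-1 else 0).
  by rewrite /T big_mkcond big_nat_recr//= -big_mkcond.
have SE : S n.+1 = S n + ln n.+1%:R * (if prime n.+1 then (n.+1%:R)^-1 else 0).
  rewrite /S big_mkcond big_nat_recr//= -big_mkcond; congr +%R.
  by case: ifP; rewrite ?mulr0.
rewrite TE SE; set b := (X in T n + X); set v := ln n.+1%:R; pose u : R := ln n%:R.
have u0 : 0 < u by apply: lk.
have v0 : 0 < v by apply: lk; lia.
have uv : u <= v by rewrite ler_ln ?posrE ?ltr0n ?ler_nat//; lia.
rewrite [(_ + v * b) / v]mulrDl [v * b]mulrC mulfK ?gt_eqF//.
have ivu : 0 <= u^-1 - v^-1 by rewrite subr_ge0 lef_pV2.
have Sn : S n - ln 4 <= u by rewrite lerBlDr; apply: sum_ln_prime_div_le; lia.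
have A : (S n - ln 4) * (u^-1 - v^-1) <= 1 - u / v.
  apply: le_trans (ler_wpM2r ivu Sn) _.
  by rewrite mulrBr divff ?gt_eqF.
have B : ln u - ln v <= u / v - 1.
  rewrite -ln_div ?posrE//.
  have := @le_ln1Dx R (u / v - 1); rewrite subrKC; apply.
  by rewrite ltrBrDl subrr divr_gt0.
have {IHn} := IHn n2; rewrite -/u.
move: A B; rewrite mulrBl !mulrBr; lra.
Qed.

(** * Lower bound on Euler's totient *)

Lemma exp2_size_primes_le (m : nat) : (0 < m)%N -> (2 ^ size (primes m) <= m)%N.
Proof.
move=> m0; apply: (@leq_trans (\prod_(p <- primes m) p)); last first.
  apply: dvdn_leq => //; rewrite (eq_bigr (fun p => p ^ 1)%N) => [|p _].
    apply: dvdn_prod_prime_powers => [|p]; first exact: primes_uniq.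
    by rewrite mem_primes expn1 => /and3P[-> _ ->].
  by rewrite expn1.
apply: (@leq_trans (\prod_(p <- primes m) 2)).
  by rewrite big_const_seq count_predT iter_muln_1.
rewrite [leqLHS]big_seq [leqRHS]big_seq; apply: leq_prod => p.
by rewrite mem_primes => /andP[/prime_gt1].
Qed.

(** Euler's product in logarithmic form: p ^ k and (p - 1) p ^ (k - 1) share the factor p ^ (k - 1),
    which cancels. *)
Lemma ln_div_totient (R : realType) (m : nat) : (0 < m)%N ->
  ln (m%:R : R) - ln (totient m)%:R =
  \sum_(p <- primes m) (ln (p%:R : R) - ln (p.-1)%:R).
Proof.
move=> m0; rewrite -{1}(partnT m0) /partn totientE//.
have -> : (\prod_(0 <= p < m.+1 | p \in predT) p ^ logn p m =
          \prod_(p <- primes m) p ^ logn p m)%N.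
  rewrite -[LHS]/(partn m predT) partnT//.
  rewrite [LHS](prod_prime_decomp m0) prime_decompE big_map.
  exact: eq_bigr.
rewrite big_seq [in X in _ - X]big_seq !ln_prod_natr.
- rewrite -sumrB [RHS]big_seq; apply: eq_bigr => p pm.
  have [pp p1] : (0 < p)%N /\ (0 < p.-1)%N.
    by move: pm; rewrite mem_primes => /andP[/prime_gt1]; lia.
  have lm : (0 < logn p m)%N by rewrite logn_gt0.
  rewrite -{1}(prednK lm) expnS !natrM !lnM ?posrE ?ltr0n ?expn_gt0 ?pp//.
  by rewrite opprD addrACA subrr addr0.
- move=> p; rewrite mem_primes => /andP[/prime_gt1 p1 _].
  by rewrite muln_gt0 expn_gt0; lia.
- by move=> p; rewrite mem_primes => /andP[/prime_gt0 p0 _]; rewrite expn_gt0 p0.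
Qed.

(** Passing from 1 / p to 1 / (p - 1) costs 1 / (p - 1) - 1 / p, which telescopes over all integers
    from 2 to y to 1 - 1 / y; this raises the constant from 3 to 4. *)
Lemma sum_inv_pred_prime_le (R : realType) (y : nat) : (2 <= y)%N ->
  \sum_(0 <= p < y.+1 | prime p) (p.-1%:R : R)^-1 <=
  ln (ln y%:R) + (4 - ln (ln 2)).
Proof.
move=> y2; suff: \sum_(0 <= p < y.+1 | prime p) (p.-1%:R : R)^-1 <=
  \sum_(0 <= p < y.+1 | prime p) (p%:R : R)^-1 + (1 - y%:R^-1).
  have yV : 0 <= (y%:R : R)^-1 by rewrite invr_ge0.
  by have := @sum_inv_prime_le R y y2; lra.
elim: y y2 => // y IHy; rewrite leq_eqVlt => /predU1P[[<-]|y2].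
  by rewrite unlock /= !addr0 invr1 addrC subrK.
have TE (f : nat -> R) : \sum_(0 <= p < y.+2 | prime p) f p =
    \sum_(0 <= p < y.+1 | prime p) f p + (if prime y.+1 then f y.+1 else 0).
  by rewrite big_mkcond big_nat_recr//= -big_mkcond.
have yy : (y.+1%:R : R)^-1 <= y%:R^-1.
  by rewrite lef_pV2 ?posrE ?ltr0n ?ler_nat//; lia.
have := IHy y2; rewrite !TE /=.
move: yy; set u := _.+1%:R^-1; set v := y%:R^-1.
set A := \sum_(_ <= _ < _ | _) _; set B := \sum_(_ <= _ < _ | _) _.
by case: ifP => _ uv; move: u v A B uv => u v A B; lra.
Qed.

(* Primes of m up to y are controlled by Mertens; at most y of them exceed y,
   each contributing at most 1 / y. *)
Lemma totient_ge (R : realType) (y m : nat) :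
    (2 <= y)%N -> (0 < m)%N -> (m <= 2 ^ y)%N ->
  m%:R <= expR (5 - ln (ln 2)) * ln y%:R * (totient m)%:R :> R.
Proof.
move=> y2 m0 my.
have ly : 0 < ln (y%:R : R) by apply: ln_gt0; rewrite ltr1n.
rewrite -ler_ln ?posrE ?mulr_gt0 ?expR_gt0 ?ltr0n ?totient_gt0//.
rewrite !lnM ?posrE ?mulr_gt0 ?expR_gt0 ?ltr0n ?totient_gt0// expRK.
rewrite -lerBlDr ln_div_totient//.
(* Each term is ln (1 + 1 / (p - 1)), at most 1 / (p - 1). *)
apply: (@le_trans _ _ (\sum_(p <- primes m) (p.-1%:R : R)^-1)).
  rewrite big_seq [leRHS]big_seq; apply: ler_sum => p.
  rewrite mem_primes => /andP[/prime_gt1 p1 _].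
  have p0 : 0 < (p.-1%:R : R) by rewrite ltr0n; lia.
  rewrite -ln_div ?posrE ?ltr0n ?(ltnW p1)//; last by rewrite -(ltr0n R).
  have -> : p%:R / p.-1%:R = 1 + p.-1%:R^-1 :> R.
    by rewrite -{1}(prednK (ltnW p1)) -natr1 mulrDl divff ?gt_eqF// mul1r.
  by apply: le_ln1Dx; rewrite (lt_trans _ (_ : 0 < _))// ?invr_gt0// ltrN10.
rewrite (bigID (fun p => p <= y)%N)/=.
have A : \sum_(p <- primes m | (p <= y)%N) (p.-1%:R : R)^-1 <=
         \sum_(0 <= p < y.+1 | prime p) (p.-1%:R : R)^-1.
  have E : perm_eq [seq p <- primes m | (p <= y)%N]
                       [seq p <- index_iota 0 y.+1 | p \in primes m].
    apply: uniq_perm; rewrite ?filter_uniq ?primes_uniq ?iota_uniq// => p.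
    by rewrite !mem_filter mem_index_iota andbC.
  rewrite -big_filter (perm_big _ E) big_filter big_mkcond [leRHS]big_mkcond.
  apply: ler_sum => p _; rewrite mem_primes.
  by case: (prime p) => //=; case: ifP; rewrite ?invr_ge0.
(* The large primes raise the constant from 4 to 5. *)
have B : \sum_(p <- primes m | ~~ (p <= y)%N) (p.-1%:R : R)^-1 <= 1.
  apply: (@le_trans _ _ (\sum_(p <- primes m) (y%:R : R)^-1)).
    rewrite big_mkcond; apply: ler_sum => p _; case: ifP => [py|_].
      by rewrite lef_pV2 ?posrE ?ltr0n ?ler_nat//; lia.
    by rewrite invr_ge0.
  rewrite big_const_seq count_predT iter_addr_0 -[_ *+ size _]mulr_natl.
  rewrite ler_pdivrMr ?ltr0n ?(ltnW y2)// mul1r ler_nat.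
  rewrite -(leq_exp2l _ _ (isT : 1 < 2)%N).
  exact: leq_trans (exp2_size_primes_le m0) my.
by have := @sum_inv_pred_prime_le R y y2; lra.
Qed.

(** * Counting the multipliers under which two keys collide *)

Lemma eqn_mod_mul2l_coprime (m d a b : nat) : coprime d m ->
  (d * a == d * b %[mod m])%N = (a == b %[mod m])%N.
Proof.
move=> cd; have H x y : (x <= y)%N ->
    (d * y == d * x %[mod m])%N = (y == x %[mod m])%N.
  move=> xy; rewrite !eqn_mod_dvd// ?leq_mul2l ?xy ?orbT//.
  by rewrite -mulnBr Gauss_dvdr// coprime_sym.
by case: (leqP b a) => [/H//|/ltnW /H]; rewrite eq_sym => ->; rewrite eq_sym.
Qed.

(* With g = gcd d m, a |-> (a %/ (m / g), a d mod m) is injective, the second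
   component being one of the at most m / (g n) small multiples of g. *)
Lemma card_small_multiple_le (m n d : nat) : (0 < n)%N ->
  (#|[set a : 'I_m | (0 < (a * d) %% m) && (n * ((a * d) %% m) < m)]|
    <= m %/ n)%N.
Proof.
move=> n0; case: (posnP m) => [m0|m0].
  by rewrite (leq_trans (max_card _))// card_ord m0.
set A := finset _.
pose g := gcdn d m.
have g0 : (0 < g)%N by rewrite gcdn_gt0 m0 orbT.
pose m' := (m %/ g)%N; pose d' := (d %/ g)%N.
have mE : m = (g * m')%N by rewrite mulnC divnK// dvdn_gcdr.
have dE : d = (g * d')%N by rewrite mulnC divnK// dvdn_gcdl.
have m'0 : (0 < m')%N by move: m0; rewrite mE muln_gt0 => /andP[].
have cop : coprime d' m'.
  by rewrite /coprime -(eqn_pmul2l g0) muln_gcdr -mE -dE muln1.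
have modE (a : nat) : ((a * d) %% m = g * ((d' * a) %% m'))%N.
  by rewrite dE mE muln_modr; congr modn; rewrite mulnCA [(a * _)%N]mulnC.
pose f (a : 'I_m) := (a %/ m', (d' * a) %% m')%N.
pose t := [seq (q, k) | q <- iota 0 g, k <- iota 1 (m' %/ n)].
(* As d' is a unit modulo m', the second component determines a modulo m'; the first supplies the
   quotient. *)
have f_inj : injective f.
  move=> a b [qab /eqP]; rewrite eqn_mod_mul2l_coprime// => /eqP rab.
  by apply: val_inj; rewrite /= (divn_eq a m') (divn_eq b m') qab rab.
have : (size (map f (enum A)) <= size t)%N.
  apply: uniq_leq_size; first by rewrite map_inj_uniq ?enum_uniq.
  move=> _ /mapP[a + ->]; rewrite mem_enum inE modE => /andP[].
  rewrite muln_gt0 g0 /= => k0; rewrite mulnCA [X in (_ < X)%N]mE ltn_pmul2l// => k1.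
  apply/allpairsP; exists (f a) => /=; split => //.
    by rewrite mem_iota /= add0n ltn_divLR// -mE.
  by rewrite mem_iota k0 /= add1n ltnS leq_divRL// mulnC ltnW.
rewrite size_map -cardE size_allpairs !size_iota => /leq_trans; apply.
by rewrite leq_divRL// -mulnA [leqRHS]mE leq_mul2l leq_trunc_div orbT.
Qed.

(** Two residues in one half-open bin differ by less than m / n. Truncated subtraction lets one
    statement cover both orders of the residues. *)
Lemma sh_bin_eq_lt (m n : nat) (a x y : 'I_m) : (0 < n)%N ->
  sh_bin n a x = sh_bin n a y -> (n * ((a * x) %% m - (a * y) %% m) < m)%N.
Proof.
move=> n0; rewrite /sh_bin; set u := ((a * x) %% m)%N; set v := ((a * y) %% m)%N.
have m0 : (0 < m)%N := leq_ltn_trans (leq0n _) (ltn_ord a).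
move=> E; case: (leqP u v) => uv; first by rewrite (eqP uv) muln0.
have m0' : 0 < m%:R :> rat by rewrite ltr0n.
have n0' : 0 < n%:R :> rat by rewrite ltr0n.
have /andP[_ H1] := floor_itv (u%:R / (m%:R / n%:R) : rat).
have /andP[H2 _] := floor_itv (v%:R / (m%:R / n%:R) : rat).
move: H1; rewrite E intrD => H1.
have := lt_le_trans H1 (lerD H2 (lexx 1)).
rewrite ltr_pdivrMr ?divr_gt0// mulrDl mul1r divfK ?gt_eqF ?divr_gt0//.
rewrite -ltrBlDl -natrB ?(ltnW uv)// ltr_pdivlMr// -natrM ltr_nat.
by rewrite mulnC.
Qed.

(** The natural number [x + (m - y)] stands for x - y modulo m. *)
Lemma modn_mul_subr (m a x y : nat) : (0 < m)%N -> (y <= m)%N ->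
    ((a * y) %% m <= (a * x) %% m)%N ->
  ((a * (x + (m - y))) %% m = (a * x) %% m - (a * y) %% m)%N.
Proof.
move=> m0 ym le; rewrite -[RHS](@modn_small _ m); last first.
  by rewrite (leq_ltn_trans (leq_subr _ _))// ltn_mod.
apply/eqP; rewrite -(eqn_modDr ((a * y) %% m)) subnK// modn_mod modnDmr.
by rewrite -mulnDr -addnA subnK// mulnDr addnC modnMDl.
Qed.

(** The factor 2 comes from the two possible orders of the residues of a x and a y, handled with the
    differences x - y and y - x. *)
Lemma card_collision_le (m n : nat) (x y : 'I_m) : (0 < n)%N -> x != y ->
  (#|[set a in mult_units m | sh_bin n a x == sh_bin n a y]|
    <= 2 * (m %/ n))%N.
Proof.
move=> n0 xy; have m0 : (0 < m)%N := leq_ltn_trans (leq0n _) (ltn_ord x).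
pose B d := [set a : 'I_m | (0 < (a * d) %% m) && (n * ((a * d) %% m) < m)]%N.
have sub : [set a in mult_units m | sh_bin n a x == sh_bin n a y]
    \subset B (x + (m - y))%N :|: B (y + (m - x))%N.
  apply/fintype.subsetP => a; rewrite !inE => /andP[ca /eqP E].
  (* Coprimality of a makes the difference nonzero; from here on the count may run over all of
     [m]. *)
  have ne : ((a * x) %% m != (a * y) %% m)%N.
    by rewrite eqn_mod_mul2l_coprime// !modn_small.
  have [H|H] := leqP ((a * y) %% m)%N ((a * x) %% m)%N.
    apply/orP; left; rewrite modn_mul_subr ?(ltnW (ltn_ord _))//.
    by rewrite sh_bin_eq_lt// andbT subn_gt0 ltn_neqAle eq_sym ne.
  apply/orP; right; rewrite modn_mul_subr ?(ltnW (ltn_ord _)) ?(ltnW H)//.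
  by rewrite sh_bin_eq_lt// andbT subn_gt0.
rewrite (leq_trans (subset_leq_card sub))// (leq_trans (leq_card_setU _ _))//.
by rewrite mul2n -addnn leq_add// card_small_multiple_le.
Qed.

(** * Second moment and expectation of the maxload *)

(** A bin holding L keys alone supplies L ^ 2 ordered colliding pairs, the diagonal included. *)
Lemma sh_maxload_sqr_le (m n : nat) (X : {set 'I_m}) (a : 'I_m) :
  (sh_maxload n X a ^ 2 <=
    \sum_(x in X) \sum_(y in X) (sh_bin n a x == sh_bin n a y))%N.
Proof.
rewrite /sh_maxload; set S := (X in (_ <= X)%N).
apply: (big_ind (fun k => k ^ 2 <= S)%N) => [//|p q hp hq|b _]; rewrite ?/S.
  by rewrite /maxn; case: (p < q)%N.
pose A := [set x in X | sh_bin n a x == b%:Z]; rewrite -/A.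
have -> : (#|A| ^ 2 = \sum_(x in A) \sum_(y in A) 1)%N.
  by rewrite sum_nat_const sum1_card.
have AX : A \subset X by apply/fintype.subsetP => x; rewrite inE => /andP[].
rewrite [leqRHS](big_setID A)/= (finset.setIidPr AX) (leq_trans _ (leq_addr _ _))//.
apply: leq_sum => x xA.
rewrite [leqRHS](big_setID A)/= (finset.setIidPr AX) (leq_trans _ (leq_addr _ _))//.
apply: leq_sum => y yA.
by move: xA yA; rewrite !inE => /andP[_ /eqP->] /andP[_ /eqP->]; rewrite eqxx.
Qed.

(** After exchanging sums, a diagonal pair counts once for every unit, any other pair for at most
    [2 * (m %/ n)] units. *)
Lemma sum_sh_maxload_sqr_le (m n : nat) (X : {set 'I_m}) : (0 < n)%N ->
  (\sum_(a in mult_units m) sh_maxload n X a ^ 2 <=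
    #|X| * (#|mult_units m| + #|X| * (2 * (m %/ n))))%N.
Proof.
move=> n0.
apply: (@leq_trans (\sum_(a in mult_units m) \sum_(x in X) \sum_(y in X)
    (sh_bin n a x == sh_bin n a y))%N).
  by apply: leq_sum => a _; apply: sh_maxload_sqr_le.
rewrite exchange_big /= -sum_nat_const; apply: leq_sum => x xX.
rewrite exchange_big /= (bigD1 x)//=; apply: leq_add.
  by rewrite -sum1_card; apply: leq_sum => a _; apply: leq_b1.
apply: (@leq_trans (\sum_(y in X | y != x) (2 * (m %/ n)))%N); last first.
  by rewrite big_mkcondr -sum_nat_const; apply: leq_sum => y _; case: ifP.
apply: leq_sum => y /andP[_ yx].
rewrite eq_sym in yx; apply: leq_trans (card_collision_le n0 yx).
rewrite -sum1_card big_mkcond [leqRHS]big_mkcond /=; apply: leq_sum => a _.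
by rewrite !inE; case: ifP => //=; case: eqP.
Qed.

Lemma card_mult_units (m : nat) : #|mult_units m| = totient m.
Proof.
rewrite totient_count_coprime big_mkord -sum1_card big_mkcond /=.
by apply: eq_bigr => a _; rewrite inE coprime_sym; case: coprime.
Qed.

(* AM-GM, L <= (L ^ 2 / t + t) / 2, replaces the Cauchy-Schwarz inequality. *)
Lemma sh_expected_maxload_le (R : realType) (m n : nat) (X : {set 'I_m}) (t A : R) :
    (0 < n)%N -> (0 < m)%N -> #|X| = n -> 0 < t ->
    m%:R <= A * (totient m)%:R ->
  sh_expected_maxload R n X <= (n%:R * (1 + 2 * A) / t + t) / 2.
Proof.
move=> n0 m0 Xn t0 mA; rewrite /sh_expected_maxload.
have f0 : 0 < #|mult_units m|%:R :> R by rewrite card_mult_units ltr0n totient_gt0.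
rewrite ler_pdivrMr//.
apply: (@le_trans _ _ (\sum_(a in mult_units m)
    (((sh_maxload n X a ^ 2)%N%:R / t + t) / 2))).
  apply: ler_sum => a _; rewrite natrX; set L := (sh_maxload n X a)%:R.
  rewrite ler_pdivlMr// -subr_ge0.
  have -> : L ^+ 2 / t + t - L * 2 = (L - t) ^+ 2 / t by field; rewrite gt_eqF.
  by rewrite mulr_ge0 ?sqr_ge0// invr_ge0 ltW.
rewrite -mulr_suml big_split/= -mulr_suml sumr_const -natr_sum -[t *+ _]mulr_natr.
rewrite [leRHS]mulrAC ler_pM2r ?invr_gt0// mulrDl lerD2r [leRHS]mulrAC ler_pM2r ?invr_gt0//.
have := @sum_sh_maxload_sqr_le m n X n0; rewrite -(ler_nat R) => /le_trans; apply.
rewrite Xn natrM natrD -mulrA ler_wpM2l// mulrDl mul1r lerD2l.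
have H : (n * (2 * (m %/ n)))%N%:R <= 2 * m%:R :> R.
  by rewrite -natrM ler_nat mulnCA leq_mul2l /= mulnC leq_trunc_div.
apply: le_trans H _.
by rewrite -mulrA ler_pM2l// card_mult_units.
Qed.

(** * Choice of parameters and conclusion *)

Theorem mainTheorem8 (R : realType) (C : R) :
  exists (K : R) (N0 : nat), 0 < K /\
    forall n m : nat,
      (N0 <= n)%N -> (0 < n)%N -> (n ^ 6 <= m)%N -> m%:R <= n%:R `^ C ->
      M_SH R m n <= K * Num.sqrt (n%:R * ln (ln n%:R)).
Proof.
have l2 : 0 < ln (2 : R) by apply: ln_gt0; rewrite ltr1n.
have l21 : ln (2 : R) <= 1.
  by have := @le_ln1Dx R 1; rewrite -[1 + 1]/(2 : R); apply; lra.
(* With this c, n ^ C is at most 2 ^ (c ln n); the added 1 ensures c >= 1. *)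
pose c : R := (`|C| + 1) / ln 2.
have c1 : 1 <= c.
  rewrite ler_pdivlMr// mul1r; apply: le_trans l21 _.
  by rewrite lerDr.
pose K1 : R := expR (5 - ln (ln 2)).
have K10 : 0 < K1 by apply: expR_gt0.
(* The threshold forces ln n >= c + 1 + e, so that ln ln n is at least both 1 and ln (c + 1). *)
exists (1 + 2 * K1), (Num.truncn (expR (c + 1 + expR 1))).+1; split.
  by rewrite addr_gt0// mulr_gt0.
move=> n m Nn n0 n6m mC.
have m0 : (0 < m)%N by apply: leq_trans n6m; rewrite expn_gt0 n0.
have n0' : 0 < n%:R :> R by rewrite ltr0n.
have lnn : c + 1 + expR 1 <= ln (n%:R : R).
  rewrite -[leLHS]expRK ler_ln ?posrE ?expR_gt0//.
  by rewrite (le_trans (ltW (truncnS_gt _)))// ler_nat.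
have e0 := @expR_gt0 R 1.
have ln0 : 0 < ln (n%:R : R) by lra.
pose l : R := ln (ln n%:R).
have l1 : 1 <= l.
  rewrite -[leLHS](@expRK R) ler_ln ?posrE//; lra.
have lc : ln (c + 1) <= l by rewrite ler_ln ?posrE//; lra.
(* The cutoff y is of order ln n: large enough for m <= 2 ^ y, small enough for ln y <= 2 ln ln
   n. *)
pose y := (Num.truncn (c * ln (n%:R : R))).+1.
have yl : c * ln (n%:R : R) < y%:R by apply: truncnS_gt.
have yu : y%:R <= c * ln (n%:R : R) + 1.
  by rewrite -natr1 lerD2r truncn_le// mulr_ge0 ?ltW//; lra.
have cl : 1 <= c * ln (n%:R : R) by rewrite -[leLHS]mul1r ler_pM//; lra.
have y2 : (2 <= y)%N by rewrite -(ltr_nat R) (le_lt_trans cl).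
have my : (m <= 2 ^ y)%N.
  rewrite -(ler_nat R) natrX (le_trans mC)//.
  rewrite -ler_ln ?posrE ?powR_gt0 ?exprn_gt0// ln_powR lnXn// -[ln 2 *+ _]mulr_natl.
  apply: (@le_trans _ _ (c * ln n%:R * ln 2)); last by rewrite ler_pM2r// ltW.
  rewrite mulrAC divfK ?gt_eqF// ler_pM2r//.
  by rewrite (le_trans (ler_norm _))// lerDl.
have lny : ln (y%:R : R) <= 2 * l.
  have : ln (y%:R : R) <= ln ((c + 1) * ln n%:R).
    rewrite ler_ln ?posrE ?ltr0n ?mulr_gt0//; lra.
  rewrite lnM ?posrE//; [rewrite -/l; lra|lra].
have mA := @totient_ge R y m y2 m0 my.
(* This t balances the AM-GM bound: with A = K1 ln y <= 2 K1 l and l >= 1, n (1 + 2 A) / t is at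
   most (1 + 4 K1) t, and averaging with t gives (1 + 2 K1) t. *)
pose t : R := Num.sqrt (n%:R * l).
have nl0 : 0 < n%:R * l by rewrite mulr_gt0//; lra.
have t0 : 0 < t by rewrite sqrtr_gt0.
have tt : n%:R * l = t * t by rewrite -expr2 sqr_sqrtr ?ltW.
rewrite -/l -/t; apply: bigmax_le => [|X /eqP Xn].
  by rewrite mulr_ge0 ?ltW// addr_gt0// mulr_gt0.
apply: le_trans (sh_expected_maxload_le n0 m0 Xn t0 mA) _.
rewrite -/K1 ler_pdivrMr// -lerBrDr ler_pdivrMr//.
have -> : ((1 + 2 * K1) * t * 2 - t) * t = n%:R * (l * (1 + 4 * K1)).
  by rewrite [RHS]mulrA tt; ring.
rewrite ler_pM2l//.
have : K1 * ln y%:R <= K1 * (2 * l) by rewrite ler_pM2l.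
lra.
Qed.
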